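(* Let $X$ be a one-dimensional shift of finite type, $(X,\phi)$ a cellular automaton, and $\mu$ a $\sigma$-invariant Borel probability measure on $X$. Then $(X,\phi)$ is $\mu$-equicontinuous if and only if it is $\mu$-LEP.
   Context: $\mathcal{A}$ is a finite alphabet, and $\mathbb{N}$ includes $0$. $\mathcal{A}^{\mathbb{Z}}$ has the product topology and the shift $\sigma$, $(\sigma x)_j=x_{j+1}$. A one-dimensional subshift is a closed $\sigma$-invariant set $X\subset\mathcal{A}^{\mathbb{Z}}$; it is a shift of finite type (SFT) if it is the set of all sequences in which no pattern from some finite list of forbidden words appears. A cellular automaton (CA) $(X,\phi)$ is a subshift $X$ with a continuous map $\phi:X\to X$ commuting with $\sigma$. Let $W_m=[-m,m]\cap\mathbb{Z}$ and let $x_{W_m}$ be the restriction of $x$ to $W_m$. For $x\in X$ put $B_n(x)=\{y\in X: y_{W_n}=x_{W_n}\}$ (ball) and $O_m(x)=\{y\in X: (\phi^i y)_{W_m}=(\phi^i x)_{W_m}\ \forall i\ge 0\}$ (orbit ball). A point $x$ is a $\mu$-equicontinuity point of $\phi$ if for all $m\in\mathbb{N}$, $\lim_{n\to\infty}\mu(B_n(x)\cap O_m(x))/\mu(B_n(x))=1$ (in particular $\mu(B_n(x))>0$ for all $n$). $(X,\phi)$ is $\mu$-equicontinuous if $\mu$-almost every $x\in X$ is a $\mu$-equicontinuity point. $LEP(\phi)$ is the set of $x\in X$ such that for every $m\in\mathbb{N}$ the sequence $i\mapsto(\phi^i x)_{W_m}$, $i\ge0$, is eventually periodic. $(X,\phi)$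 is $\mu$-LEP ($\mu$-locally eventually periodic) if $\mu(LEP(\phi))=1$. *)

(* Defs.v *)
From HB Require Import structures.
From mathcomp Require Import all_boot all_order all_algebra.
From mathcomp Require Import all_classical all_reals all_analysis.

Set Implicit Arguments.
Unset Strict Implicit.
Unset Printing Implicit Defensive.

Import Order.TTheory GRing.Theory Num.Theory.
Import numFieldNormedType.Exports.

Local Open Scope classical_set_scope.
Local Open Scope ring_scope.

(* Alphabets are pointed because MathComp-Analysis measurable types are.
   Nothing is lost: over an empty alphabet there is no configuration, hence no
   probability measure. Finiteness is a separate hypothesis. *)
Definition config (A : pointedType) : Type :=
  prod_topology (fun _ : int => discrete_topology A).

HB.instance Definition _ (A : pointedType) := Pointed.on (config A).
HB.instance Definition _ (A : pointedType) := Nbhs.on (config A).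
HB.instance Definition _ (A : pointedType) := Topological.on (config A).

Definition borel_config (A : pointedType) :=
  g_sigma_algebraType (@open (config A)).

Section Dynamics.
Context {A : pointedType}.
Implicit Types (X : set (config A)) (phi : config A -> config A).
Implicit Types (x y : config A).

Definition shift x : config A := fun j => x (j + 1).

Definition subshift X : Prop := closed X /\ shift @` X = X.

Definition occurs_at (w : seq A) x (j : int) : Prop :=
  [seq x (j + i%:Z) | i <- iota 0 (size w)] = w.

Definition sft X : Prop :=
  subshift X /\
  exists F : seq (seq A),
    X = [set x | forall w, w \in F -> forall j : int, ~ occurs_at w x j].

(* A map X -> X is represented by a total map sending X into X; its values
   outside X are irrelevant. *)
Definition cellular_automaton X phi : Prop :=
  [/\ subshift X,
      (forall x, X x -> X (phi x)),
      {within X, continuous phi} &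
      (forall x, X x -> phi (shift x) = shift (phi x))].

(* The restriction of x to [-m, m], reindexed by 0, ..., 2m. *)
Definition window (m : nat) x : {ffun 'I_(m.*2.+1) -> A} :=
  [ffun k : 'I_(m.*2.+1) => x (k%:Z - m%:Z)].

Definition cyl_ball X (n : nat) x : set (config A) :=
  [set y | X y /\ window n y = window n x].

Definition orbit_ball X phi (m : nat) x : set (config A) :=
  [set y | X y /\
    forall i : nat, window m (iter i phi y) = window m (iter i phi x)].

Definition eventually_periodic {T : Type} (u : nat -> T) : Prop :=
  exists p i0 : nat, (0 < p)%N /\
    forall i : nat, (i0 <= i)%N -> u (i + p)%N = u i.

Definition LEP X phi : set (config A) :=
  [set x | X x /\
    forall m : nat, eventually_periodic (fun i => window m (iter i phi x))].

End Dynamics.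

(* A Borel probability measure on X is represented by its extension to all
   configurations, i.e. by a Borel probability mu with mu X = 1. *)
Section MeasureDynamics.
Context {R : realType} {A : pointedType}.
Implicit Types (mu : probability (borel_config A) R).
Implicit Types (X : set (config A)) (phi : config A -> config A).

Definition shift_invariant mu : Prop :=
  forall B : set (borel_config A), measurable B -> mu (shift @^-1` B) = mu B.

Definition mu_equicontinuity_point X phi mu (x : config A) : Prop :=
  forall m : nat,
    (forall n : nat, (0 < mu (cyl_ball X n x))%E) /\
    fine (mu (cyl_ball X n x `&` orbit_ball X phi m x))
      / fine (mu (cyl_ball X n x)) @[n --> \oo] --> (1 : R).

Definition mu_equicontinuous X phi mu : Prop :=
  {ae mu, forall x, X x -> mu_equicontinuity_point X phi mu x}.

Definition mu_LEP X phi mu : Prop := mu (LEP X phi) = 1%E.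

End MeasureDynamics.

(* Main.v *)
From mathcomp Require Import all_boot all_order all_algebra.
From mathcomp Require Import all_classical all_reals all_analysis.
From mathcomp Require Import finmap zify lra.
(* Imported last because all_analysis has its own [shift]. *)
Require Import Defs.

Set Implicit Arguments.
Unset Strict Implicit.
Unset Printing Implicit Defensive.

Import Order.TTheory GRing.Theory Num.Theory.
Import numFieldNormedType.Exports.

(* If x is a mu-equicontinuity point, then mu(O_m(x)) > 0 for every m. By
   Poincare recurrence for the shift there are y and an arbitrarily large j
   with y and sigma^j y both in O_m(x): the columns of y at 0 and at j evolve
   identically. When m exceeds the radius of phi and the sizes of the forbidden
   words, the j-periodic point z with z = y on [0, j) lies in X, and phi^i z
   stays the periodization of phi^i y for all i. The orbit of z lives in the
   finite set of j-periodic points, so it is eventually periodic, and hence so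
   is the common column of x, y and z.

   Conversely, a point of LEP(phi) lies, for each m, in one of the countably
   many closed sets E_{m,p,i0} of points whose column of width 2m+1 has period p
   from time i0 on. Near a point x of E_{m,p,i0} this set is contained in
   O_m(x), so it suffices that almost every point of a closed set E be a density
   point of E. If C_K is the union of the K-balls meeting E, the points lying in
   some n-ball B (n >= K) that meets E with mu(B) <= c mu(B \ E) form a set of
   measure at most c mu(C_K \ E), because balls are nested or disjoint, and
   mu(C_K \ E) tends to 0. *)

Local Open Scope classical_set_scope.

(** * Pigeonhole and finite function spaces *)

Lemma finite_collision (T : Type) (u : nat -> T) : finite_set [set: T] ->
  exists p i : nat, (0 < p)%N /\ u (i + p)%N = u i.
Proof.
move=> finT; apply: contrapT => nu; apply: infinite_nat.
have -> : [set: nat] = u @^-1` [set: T] by [].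
apply: finite_preimage => // i k _ _ uik.
have [ik|ki|//] := ltngtP i k; exfalso; apply: nu.
  by exists (k - i)%N, i; split; [lia | rewrite subnKC// ltnW].
by exists (i - k)%N, k; split; [lia | rewrite subnKC// ltnW].
Qed.

Lemma finite_ffun (I : finType) (A : pointedType) :
  finite_set [set: A] -> finite_set [set: {ffun I -> A}].
Proof.
move=> finA; pose s := enum_fset (fset_set [set: A]).
pose decode (g : {ffun I -> 'I_(size s)}) : {ffun I -> A} :=
  [ffun i => nth point s (g i)].
have ins a : a \in s.
  have : a \in fset_set [set: A] by rewrite in_fset_set//; exact/mem_set.
  by [].
apply: (@sub_finite_set _ _ (decode @` setT)); last first.
  exact/finite_image/finite_finset.
move=> g _; have lt_s i : (index (g i) s < size s)%N by rewrite index_mem.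
exists [ffun i => Ordinal (lt_s i)] => //.
by apply/ffunP => i; rewrite !ffunE nth_index.
Qed.

(** * Windows and the product topology *)

Section Windows.
Context {A : pointedType}.
Implicit Types (x y : config A) (X : set (config A)).

Lemma windowP n x y :
  window n x = window n y <-> (forall k : int, (`|k| <= n)%N -> x k = y k).
Proof.
split=> [/ffunP xy k kn|xy]; last first.
  by apply/ffunP => k; rewrite !ffunE; apply: xy; have := ltn_ord k; lia.
have kP : (`|(k + n%:Z)%R| < n.*2.+1)%N by lia.
have := xy (Ordinal kP); rewrite !ffunE /=.
by have -> : (`|(k + n%:Z)%R|%N%:Z - n%:Z = k)%R by lia.
Qed.

Lemma window_le m n x y :
  (m <= n)%N -> window n x = window n y -> window m x = window m y.
Proof.
by move=> mn /windowP xy; apply/windowP => k km; apply: xy; exact: leq_trans mn.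
Qed.

Lemma nbhs_cylinder n x : nbhs x [set y : config A | window n y = window n x].
Proof.
have : \forall y \near x, forall k : 'I_(n.*2.+1),
    y (k%:Z - n%:Z)%R = x (k%:Z - n%:Z)%R.
  apply: (@filter_forall _ _ (fun (k : 'I_(n.*2.+1)) (y : config A) =>
    y (k%:Z - n%:Z)%R = x (k%:Z - n%:Z)%R) _ (nbhs_filter x)) => k.
  by apply: (@proj_continuous _ (fun=> discrete_topology A) _ x
    [set x (k%:Z - n%:Z)%R]); exact: discrete_set1.
apply: filterS => y yx /=; apply/ffunP => k; rewrite !ffunE; exact: yx.
Qed.

Lemma window_preimage_open n (S : set {ffun 'I_(n.*2.+1) -> A}) :
  open (window n @^-1` S : set (config A)).
Proof.
rewrite openE => x Sx; apply: filterS (nbhs_cylinder n x) => y /= yx.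
by rewrite /= yx.
Qed.

(** The filter generated by the cylinders at [x] converges to [x] in each coordinate, hence in the
    product topology. *)
Lemma nbhs_configP x (U : set (config A)) :
  nbhs x U -> exists n, [set y | window n y = window n x] `<=` U.
Proof.
pose F : set_system (config A) :=
  filter_from setT (fun n => [set y | window n y = window n x]).
have FF : Filter F.
  apply: filter_from_filter; first by exists 0%N.
  move=> m n _ _; exists (maxn m n) => // y yx; split; apply: window_le yx.
    exact: leq_maxl.
  exact: leq_maxr.
have Fx : F --> x.
  apply/cvg_sup => i; apply/cvg_image => [|U' xU'].
    by apply/seteqP; split => // a _; exists (fun=> a).
  exists (proj i @^-1` U').
    exists `|i|%N => // y /windowP yx /=; rewrite /proj yx//.
    exact: nbhs_singleton xU'.
  by apply/seteqP; split=> [_ [y yU <-]//|a aU]; exists (fun=> a).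
by move=> /Fx [n _ nU]; exists n.
Qed.

Lemma compact_config : finite_set [set: A] -> compact [set: config A].
Proof.
move=> finA.
have cA : compact [set: discrete_topology A] by exact: finite_compact.
have := @tychonoff int (fun=> discrete_topology A) (fun=> setT) (fun=> cA).
by congr compact; apply/seteqP; split.
Qed.

End Windows.

(** * Translations and the local rule *)

Section CellularAutomata.
Local Open Scope ring_scope.
Context {A : pointedType} (X : set (config A)) (phi : config A -> config A).
Hypothesis CA : cellular_automaton X phi.
Implicit Types (x y : config A).

Definition translate (j : int) x : config A := fun k => x (k + j)%R.

Lemma translate_natS (n : nat) x :
  translate n.+1%:Z x = translate n%:Z (shift x).
Proof. by apply/funext => k; rewrite /translate /shift; congr x; lia. Qed.

Lemma subshift_shift x : X x -> X (shift x).
Proof. by case: CA => -[_ XE] _ _ _ Xx; rewrite -XE; exists x. Qed.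

Lemma subshift_unshift x : X x -> X (translate (-1) x).
Proof.
case: CA => -[_ XE] _ _ _; rewrite -{1}XE => -[y Xy <-].
suff -> : translate (-1) (shift y) = y by [].
by apply/funext => k; rewrite /translate /shift; congr y; lia.
Qed.

Lemma subshift_translate j x : X x -> X (translate j x).
Proof.
move=> Xx; elim: j => [|n IH|n IH].
- suff -> : translate 0 x = x by [].
  by apply/funext => k; rewrite /translate addr0.
- suff -> : translate n.+1%:Z x = shift (translate n%:Z x).
    exact: subshift_shift.
  by apply/funext => k; rewrite /translate /shift; congr x; lia.
- suff -> : translate (- n.+1%:Z) x = translate (-1) (translate (- n%:Z) x).
    exact: subshift_unshift.
  by apply/funext => k; rewrite /translate; congr x; lia.
Qed.

Lemma phi_translate_nat (n : nat) x :
  X x -> phi (translate n%:Z x) = translate n%:Z (phi x).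
Proof.
case: CA => _ _ _ phiS; elim: n x => [|n IH] x Xx.
  have t0 y : translate 0 y = y.
    by apply/funext => k; rewrite /translate addr0.
  by rewrite !t0.
rewrite translate_natS IH; last exact: subshift_shift.
by rewrite phiS// -translate_natS.
Qed.

Lemma phi_translate j x : X x -> phi (translate j x) = translate j (phi x).
Proof.
move=> Xx; have [[n ->]|[n jE]] : (exists n : nat, j = n%:Z) \/
    (exists n : nat, j = - n%:Z)%R.
- by case: j => n; [left; exists n|right; exists n.+1; lia].
- exact: phi_translate_nat.
have tK y : translate j (translate n%:Z y) = y.
  by apply/funext => k; rewrite /translate; congr y; lia.
have tK' y : translate n%:Z (translate j y) = y.
  by apply/funext => k; rewrite /translate; congr y; lia.
have := phi_translate_nat n (subshift_translate j Xx).
by rewrite tK' => ->; rewrite tK.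
Qed.

Hypothesis finA : finite_set [set: A].

(* Curtis-Hedlund-Lyndon *)
Lemma local_rule : exists r : nat, forall x y, X x -> X y ->
  window r x = window r y -> phi x 0 = phi y 0.
Proof.
have cX : compact X.
  by case: CA => -[clX _] _ _ _;
    apply: subclosed_compact clX (compact_config finA) _.
(* Compactness in near-covering form replaces radii depending on the point by a single [r]. *)
move: cX => /compact_near_coveringP/(_ nat \oo (fun r y => X y ->
  forall z, X z -> window r y = window r z -> phi y 0 = phi z 0)).
case=> [x Xx|r _ rP]; last first.
  by exists r => x y Xx; apply: (rP r _ x Xx Xx) => /=.
case: CA => _ _ phiC _.
have : @nbhs_subspace _ X x (phi @^-1` [set y | window 0 y = window 0 (phi x)]).
  exact: (phiC x _ (nbhs_cylinder 0 _)).
rewrite -(nbhs_subspace_in Xx) => /nbhs_configP[n nP].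
have phi0 y : X y -> window n y = window n x -> phi y 0 = phi x 0.
  by move=> Xy yx; have /windowP := nP y yx Xy; apply.
exists ([set y | window n y = window n x], [set r | (n <= r)%N]).
  by split; [exact: nbhs_cylinder | exists n].
move=> [y r] /= [yx nr] Xy z Xz yz.
rewrite (phi0 y)// (phi0 z)// -yx; apply/esym; exact: window_le yz.
Qed.

End CellularAutomata.

(** * Finite propagation and periodization *)

Section LocalDynamics.
Local Open Scope ring_scope.
Context {A : pointedType} (X : set (config A)) (phi : config A -> config A).
Hypotheses (CA : cellular_automaton X phi) (r : nat).
Hypothesis phi_local : forall x y, X x -> X y ->
  window r x = window r y -> phi x 0 = phi y 0.
Implicit Types (x y : config A).

Lemma phi_local_at k x y : X x -> X y ->
  (forall l : int, (`|l| <= r)%N -> x (l + k) = y (l + k)) -> phi x k = phi y k.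
Proof.
move=> Xx Xy xy; have phiE z : X z -> phi z k = phi (translate k z) 0.
  by move=> Xz; rewrite (phi_translate CA)// /translate add0r.
rewrite !phiE//; apply: phi_local; try exact: (subshift_translate CA).
by apply/windowP => l lr; exact: xy.
Qed.

Lemma iter_mem i x : X x -> X (iter i phi x).
Proof. by move=> Xx; elim: i => //= i; case: CA => _ + _ _; apply. Qed.

(** Information travels at most [r] cells per step, so each iterate costs [r] cells at either end of
    the window. *)
Lemma window_iter i n x y : X x -> X y ->
  window (n + i * r) x = window (n + i * r) y ->
  window n (iter i phi x) = window n (iter i phi y).
Proof.
move=> Xx Xy; elim: i n => [|i IH] n; first by rewrite addn0.
move=> xy; apply/windowP => k kn; apply: phi_local_at; try exact: iter_mem.
move=> l lr; have /windowP : window (n + r) (iter i phi x) =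
    window (n + r) (iter i phi y) by apply: IH; rewrite -addnA -mulSn.
by apply; lia.
Qed.

Definition periodize (j : nat) x : config A := fun k => x (k %% j)%Z.

Lemma periodizeDM j x (k l : int) :
  periodize j x (k + l * j%:Z) = periodize j x k.
Proof. by rewrite /periodize addrC modzMDl. Qed.

(** On [0, j) this is the definition; the matching windows at 0 and [j] extend it by [m] cells to
    either side. *)
Lemma periodize_agree j m x (k : int) : (m < j)%N ->
  window m x = window m (translate j%:Z x) ->
  - m%:Z <= k <= j%:Z + m%:Z -> periodize j x k = x k.
Proof.
move=> mj /windowP xj kP; rewrite /periodize.
have [k0|k0] := ltP k 0.
  rewrite -(modzDr k j%:Z) modz_small; last by lia.
  by rewrite -[LHS]/(translate j x k) -xj//; lia.
have [kj|kj] := ltP k j%:Z; first by rewrite modz_small//; lia.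
rewrite -{1}(subrK j%:Z k) modzDr modz_small; last by lia.
by rewrite xj ?/translate; [congr x; lia | lia].
Qed.

(** Both sides are [j]-periodic, so it suffices to look at cells of [0, j), whose neighbourhoods of
    radius [r <= m] lie where [x] and its periodization agree. *)
Lemma periodize_phi j m x : (m < j)%N -> (r <= m)%N ->
  X x -> X (periodize j x) ->
  window m x = window m (translate j%:Z x) ->
  phi (periodize j x) = periodize j (phi x).
Proof.
move=> mj rm Xx Xp xj; have j0 : (j%:Z != 0) by lia.
have pT l : translate (l * j%:Z) (periodize j x) = periodize j x.
  by apply/funext => k; rewrite /translate periodizeDM.
apply/funext => k; rewrite [RHS]/periodize.
rewrite -(pT (- (k %/ j)%Z)) (phi_translate CA)// /translate.
have -> : k + - (k %/ j)%Z * j = (k %% j)%Z.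
  by rewrite {1}(divz_eq k j) mulNr addrAC subrr add0r.
apply: phi_local_at => // l lr; apply: (periodize_agree mj xj).
have := modz_ge0 k j0; have := ltz_mod k j0; lia.
Qed.

(** A forbidden word in the periodization can be moved by a multiple of [j] to start in [0, j);
    being no longer than [m], it then occurs in [x]. *)
Lemma periodize_sft (F : seq (seq A)) m j x : (m < j)%N ->
  X = [set x | forall w, w \in F -> forall j : int, ~ occurs_at w x j] ->
  (forall w, w \in F -> (size w <= m)%N) ->
  window m x = window m (translate j%:Z x) -> X x -> X (periodize j x).
Proof.
move=> mj -> Fm xj Fx w Fw k; have j0 : (j%:Z != 0) by lia.
have sw := Fm _ Fw; move=> wP; apply: (Fx w Fw (k %% j)%Z).
rewrite /occurs_at -[RHS]wP; apply/eq_in_map => i.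
rewrite mem_iota => /andP[_ iw].
have im : (i < m)%N := leq_trans iw sw.
rewrite [in RHS](divz_eq k j) -[in RHS]addrA [in RHS]addrC periodizeDM.
have := modz_ge0 k j0; have := ltz_mod k j0 => *.
by rewrite (periodize_agree mj xj)//; lia.
Qed.

Lemma iter_periodize j m x i : (m < j)%N -> (r <= m)%N ->
  X x -> X (periodize j x) ->
  (forall i,
    window m (iter i phi x) = window m (translate j%:Z (iter i phi x))) ->
  iter i phi (periodize j x) = periodize j (iter i phi x).
Proof.
move=> mj rm Xx Xp xj; elim: i => //= i IH; rewrite IH.
apply: (periodize_phi mj rm) => //; first exact: iter_mem.
by rewrite -IH; exact: iter_mem.
Qed.

Lemma recurrent_column_periodic j m x : finite_set [set: A] ->
  (m < j)%N -> (r <= m)%N -> X x -> X (periodize j x) ->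
  (forall i,
    window m (iter i phi x) = window m (translate j%:Z (iter i phi x))) ->
  eventually_periodic (fun i => window m (iter i phi x)).
Proof.
move=> finA mj rm Xx Xp xj; set z := periodize j x.
have zE i : iter i phi z = periodize j (iter i phi x).
  exact: (iter_periodize i mj rm).
have [p [i0 [p0 zi0]]] := finite_collision (fun i => window j (iter i phi z))
  (finite_ffun _ finA).
(* A [j]-periodic point is determined by its cells in [0, j), all seen by [window j], so a repeated
   window is a repeated point. *)
have zp : iter (i0 + p) phi z = iter i0 phi z.
  move: zi0 => /windowP; rewrite !zE => zi0; apply/funext => k.
  have j0 : (j%:Z != 0) by lia.
  have := modz_ge0 k j0; have := ltz_mod k j0 => kj k0.
  by have := zi0 (k %% j)%Z; rewrite /periodize modz_mod; apply; lia.
exists p, i0; split=> // i ii0.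
have zp' : iter (i + p) phi z = iter i phi z.
  rewrite -(subnK ii0) -addnA iterD zp -iterD //.
have colE l : window m (iter l phi z) = window m (iter l phi x).
  by apply/windowP => k km; rewrite zE (periodize_agree mj (xj l))//; lia.
by rewrite -!colE zp'.
Qed.

End LocalDynamics.

(** * Comparing measures over disjoint unions *)

Section MeasureGeneral.
Local Open Scope ring_scope.
Local Open Scope ereal_scope.
Context d (T : measurableType d) (R : realType).
Context (mu : {measure set T -> \bar R}).
Implicit Types (G H : set T) (c : R).

(** Both sides are additive over the pieces, which will be the balls of one radius. *)
Lemma le_measure_fin_bigcup (I : choiceType) (D : set I) (F : I -> set T)
    G H c :
  finite_set D -> trivIset D F -> (forall i, D i -> measurable (F i)) ->
  measurable G -> measurable H ->
  (forall i, D i -> mu (F i `&` G) <= c%:E * mu (F i `&` H)) ->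
  mu (\bigcup_(i in D) F i `&` G) <= c%:E * mu (\bigcup_(i in D) F i `&` H).
Proof.
move=> finD tF mF mG mH FGH.
have muE K : measurable K ->
    mu (\bigcup_(i in D) F i `&` K) = \sum_(i \in D) mu (F i `&` K).
  move=> mK; rewrite setI_bigcupl measure_fin_bigcup//.
    exact: trivIset_setIr.
  by move=> i Di; apply: measurableI => //; exact: mF.
by rewrite !muE// ge0_mule_fsumr//; exact: lee_fsum.
Qed.

Lemma le_measure_bigcup (F : nat -> set T) G H c :
  trivIset setT F -> (forall i, measurable (F i)) ->
  measurable G -> measurable H ->
  (forall i, mu (F i `&` G) <= c%:E * mu (F i `&` H)) ->
  mu (\bigcup_i F i `&` G) <= c%:E * mu (\bigcup_i F i `&` H).
Proof.
move=> tF mF mG mH FGH.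
have muE K : measurable K ->
    mu (\bigcup_i F i `&` K) = \sum_(i <oo) mu (F i `&` K).
  move=> mK; have mFK i : measurable (F i `&` K) by exact: measurableI.
  rewrite setI_bigcupl measure_semi_bigcup//.
    exact: trivIset_setIr.
  exact: bigcupT_measurable.
by rewrite !muE// -nneseriesZl//; exact: lee_nneseries.
Qed.

End MeasureGeneral.

(** * Poincare recurrence *)

Section Recurrence.
Local Open Scope ring_scope.
Context d (T : measurableType d) (R : realType) (P : probability T R).
Variables (f : T -> T) (O : set T).
Hypotheses (mf : measurable_fun setT f) (mO : measurable O).
Hypothesis Pf : forall B, measurable B -> P (f @^-1` B) = P B.

Lemma preimage_iter_invariant n :
  measurable (iter n f @^-1` O) /\ P (iter n f @^-1` O) = P O.
Proof.
elim: n => [//|n [mn Pn]].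
have -> : iter n.+1 f @^-1` O = f @^-1` (iter n f @^-1` O).
  by apply/seteqP; split => x; rewrite /preimage /= -iterS iterSr.
by split; [rewrite -[X in measurable X]setTI; exact: mf | rewrite Pf].
Qed.

(** The preimages of [O] under [iter (k * J) f] all have measure [P O > 0], so they cannot be
    pairwise disjoint; a common point of two of them yields a return time that is a positive
    multiple of [J]. *)
Lemma poincare_recurrence J : (0 < P O)%E -> (0 < J)%N ->
  exists n x, [/\ (J <= n)%N, O x & O (iter n f x)].
Proof.
move=> PO J0; apply: contrapT => nrec.
pose F k := iter (k * J) f @^-1` O.
have tF : trivIset setT F.
  apply: ltn_trivIset => k i ik; apply/eqP/negPn/negP => /set0P[x [Oi Ok]].
  apply: nrec; exists ((k - i) * J)%N, (iter (i * J) f x); split => //.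
    by rewrite leq_pmull// subn_gt0.
  by rewrite -iterD -mulnDl subnK// ltnW.
have mF k : measurable (F k) by have [] := preimage_iter_invariant (k * J).
have PF k : P (F k) = P O by have [] := preimage_iter_invariant (k * J).
have finO : P O \is a fin_num by exact: fin_num_measure.
have ge N : fine (P O) *+ N <= 1.
  have mU : measurable (\big[setU/set0]_(i < N) F i).
    exact: bigsetU_measurable.
  have := probability_le1 P mU; rewrite measure_bigsetU//.
  rewrite (eq_bigr (fun=> (fine (P O))%:E)) => [|i _]; last first.
    by rewrite fineK// -(PF i).
  by rewrite sumEFin sumr_const card_ord lee_fin.
have e0 : 0 < fine (P O) by rewrite -lte_fin fineK.
have := ge (Num.bound (fine (P O))^-1).
apply/negP; rewrite -ltNge -[_ *+ _]mulr_natr -ltr_pdivrMl// mulr1.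
by apply: archi_boundP; rewrite invr_ge0 ltW.
Qed.

End Recurrence.

(** * Unions of balls and the sparse-ball estimate *)

Section LocalSets.
Context {A : pointedType} (finA : finite_set [set: A]) (X : set (config A)).
Hypothesis clX : closed X.
Implicit Types (D E : set (config A)) (x y : config A).

(** These are the unions of [n]-balls of [X]. *)
Definition local_set n D := D `<=` X /\
  forall x y, D x -> X y -> window n x = window n y -> D y.

Lemma measurable_closed_config D :
  closed D -> measurable (D : set (borel_config A)).
Proof.
move=> clD; rewrite -[D]setCK; apply: measurableC.
by apply: sub_sigma_algebra; exact: closed_openC.
Qed.

Lemma measurable_local n D :
  local_set n D -> measurable (D : set (borel_config A)).
Proof.
move=> [DX Dn].
have -> : D = X `&` window n @^-1` (window n @` D).
  apply/seteqP; split=> [x Dx|x [Xx [y Dy yx]]]; last exact: (Dn y).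
  by split; [exact: DX | exists x].
apply: measurableI; first exact: measurable_closed_config.
by apply: sub_sigma_algebra; exact: window_preimage_open.
Qed.

Lemma cyl_ball_local n x : local_set n (cyl_ball X n x).
Proof. by split=> [y []//|y z [_ yx] Xz yz]; split=> //; rewrite -yz. Qed.

(** The sets removed from [F i] have smaller radii, so the window of radius [n + i] decides them
    too. *)
Lemma local_seqDU n (F : nat -> set (config A)) i :
  (forall k, local_set (n + k) (F k)) -> local_set (n + i) (seqDU F i).
Proof.
move=> Floc; have FX := (fun k => proj1 (Floc k)).
split=> [x [/FX]//|x y [Fx nFx] Xy xy]; split.
  by case: (Floc i) => _; apply; first exact: Fx.
rewrite -bigcup_mkord => -[k /= ki Fy]; apply: nFx; rewrite -bigcup_mkord.
exists k => //; have [_ +] := Floc k; apply; first exact: Fy.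
- by move: Fx => /FX.
- by apply/esym; apply: window_le xy; rewrite leq_add2l ltnW.
Qed.

Context {R : realType} (mu : probability (borel_config A) R).
Local Open Scope ring_scope.
Local Open Scope ereal_scope.

(** [D] splits into the balls around its points, finitely many since [A] is finite, and the
    estimates on them add up. *)
Lemma le_measure_local n D (G H : set (borel_config A)) c :
  local_set n D -> measurable G -> measurable H ->
  (forall x, D x ->
    mu (cyl_ball X n x `&` G) <= c%:E * mu (cyl_ball X n x `&` H)) ->
  mu (D `&` G) <= c%:E * mu (D `&` H).
Proof.
move=> [DX Dn] mG mH DGH.
pose F (w : {ffun 'I_(n.*2.+1) -> A}) := [set x | X x /\ window n x = w].
have DE : D = \bigcup_(w in window n @` D) F w.
  apply/seteqP; split=> [x Dx|x [_ [y Dy <-] [Xx xy]]]; last exact: (Dn y).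
  by exists (window n x); [exists x | split=> //; exact: DX].
rewrite DE; apply: le_measure_fin_bigcup => //.
- by apply: sub_finite_set (finite_ffun _ finA).
- apply/trivIsetP => v w _ _ /eqP vw; apply/seteqP.
  by split=> // x [[_ xv] [_ xw]]; apply: vw; rewrite -xv.
- by move=> _ [x Dx <-]; apply: measurable_local (cyl_ball_local n x).
- by move=> _ [x Dx <-]; exact: DGH.
Qed.

Lemma null_balls_negligible n :
  mu.-negligible [set x | X x /\ mu (cyl_ball X n x) = 0].
Proof.
set Z := [set x | _].
have Zloc : local_set n Z.
  split=> [x []//|x y [Xx x0] Xy xy]; split => //.
  by rewrite -x0; congr (mu _); apply/seteqP; split=> z [Xz zx]; split => //;
    rewrite ?xy// -xy.
have mZ := measurable_local Zloc.
exists Z; split => //; apply/eqP; rewrite -measure_le0.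
(* Comparison with constant [c = 0], both test sets being the whole space. *)
rewrite -[Z in leLHS]setIT -(mul0e (mu (Z `&` setT))).
apply: (le_measure_local Zloc) => // x [Xx x0].
by rewrite setIT x0 mul0e.
Qed.

Section Density.
Variable E : set (borel_config A).
Hypothesis mE : measurable E.

(** For [E] inside [X], this is the union of the [n]-balls that meet [E], the set C_K of the
    overview. *)
Definition neighborhood n : set (config A) :=
  [set x | X x /\ exists2 y, E y & window n x = window n y].

(** Closedness of [E] in [X] in terms of windows: the intersection is the closure of [E] within
    [X]. *)
Hypothesis clE : \bigcap_n neighborhood n `<=` E.

(** For [c > 0], the complement of [E] takes up at least 1/c of the ball; the division-free form
    also covers null balls. *)
Definition sparse c n : set (config A) := [set x | neighborhood n x /\
  mu (cyl_ball X n x) <= c%:E * mu (cyl_ball X n x `\` E)].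

Lemma local_neighborhood n : local_set n (neighborhood n).
Proof.
split=> [x []//|x y [Xx [z Ez xz]] Xy xy]; split=> //.
by exists z => //; rewrite -xy.
Qed.

Lemma neighborhood_le m n : (m <= n)%N -> neighborhood n `<=` neighborhood m.
Proof.
move=> mn x [Xx [y Ey xy]]; split=> //.
by exists y => //; exact: window_le xy.
Qed.

Lemma local_sparse c n : local_set n (sparse c n).
Proof.
split=> [x [[]]//|x y [nx sx] Xy xy]; split.
  by have [_] := local_neighborhood n; apply; first exact: nx.
suff <- : cyl_ball X n x = cyl_ball X n y by [].
by rewrite /cyl_ball xy.
Qed.

(* [seqDU] picks for each point its largest sparse ball of radius at least K,
   so the selected balls are disjoint. *)
Lemma measure_sparse_tail c K : (0 <= c)%R ->
  mu (\bigcup_n sparse c (K + n)) <= c%:E * mu (neighborhood K `\` E).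
Proof.
move=> c0; have Wloc i := local_seqDU i (fun k => local_sparse c (K + k)).
have mW i := measurable_local (Wloc i).
have mnE : measurable (~` E) by exact: measurableC.
rewrite seqDU_bigcup_eq -[X in mu X <= _]setIT.
apply: (@le_trans _ _ (c%:E *
    mu (\bigcup_k seqDU (fun n => sparse c (K + n)) k `&` ~` E))).
  apply: (le_measure_bigcup (@trivIset_seqDU _ _)) => //.
  move=> i; apply: (le_measure_local (Wloc i)) => // x [[_ xs] _].
  by rewrite setIT -setDE.
apply: lee_wpmul2l; first by rewrite lee_fin.
apply: le_measure.
- by apply/mem_set; apply: measurableI => //; exact: bigcupT_measurable.
- by apply/mem_set; apply: measurableD => //;
    exact: measurable_local (local_neighborhood K).
- move=> x [[n _ [[xn _] _]] nEx]; split=> //.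
  exact: neighborhood_le (leq_addr n K) _ xn.
Qed.

(** The set lies in every tail, of measure at most [c] times that of [neighborhood K] minus [E], and
    these differences decrease to the empty set because [E] is closed. *)
Lemma sparse_limsup_negligible c : (0 <= c)%R ->
  mu.-negligible (\bigcap_K \bigcup_n sparse c (K + n)).
Proof.
move=> c0.
have mU K :
    measurable (\bigcup_n sparse c (K + n) : set (borel_config A)).
  by apply: bigcupT_measurable => n; exact: measurable_local (local_sparse c _).
have mI :
    measurable (\bigcap_K \bigcup_n sparse c (K + n) : set (borel_config A)).
  exact: bigcapT_measurable.
have mC K : measurable (neighborhood K `\` E : set (borel_config A)).
  by apply: measurableD => //; exact: measurable_local (local_neighborhood K).
exists (\bigcap_K \bigcup_n sparse c (K + n)); split=> //.
have C0 : \bigcap_K (neighborhood K `\` E) = set0.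
  apply/seteqP; split=> // x xC; have [_] := xC 0%N I; apply.
  by apply: clE => K _; have [] := xC K I.
have cvC : mu (neighborhood K `\` E) @[K --> \oo] --> 0.
  rewrite -(measure0 mu) -C0; apply: nonincreasing_cvg_mu => //.
  - by rewrite (le_lt_trans (probability_le1 _ _))// ltry.
  - exact: bigcapT_measurable.
  - move=> m n mn; apply/subsetPset => x [xn nEx]; split=> //.
    exact: neighborhood_le mn _ xn.
apply/eqP; rewrite -measure_le0 -(mule0 c%:E).
apply: cvge_ge (cvgeZl _ cvC) => //.
apply: nearW => K; apply: le_trans (measure_sparse_tail K c0).
by apply: le_measure; [exact: mem_set|exact: mem_set|move=> x; apply].
Qed.

End Density.

End LocalSets.

(** * Density points *)

Section DensityPoint.
Local Open Scope ring_scope.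
Context {A : pointedType} (X : set (config A)) (clX : closed X).
Context {R : realType} (mu : probability (borel_config A) R).

(** Avoiding the limsup set for the constant [k.+1] keeps the part of small balls outside [E] below
    the proportion 1/(k+1); inside the ball of radius [n0], [O] contains [E]. *)
Lemma density_point (E O : set (borel_config A)) x n0 :
  measurable E -> measurable O -> E x -> X x ->
  (forall n, (0 < mu (cyl_ball X n x))%E) ->
  (forall k : nat,
    ~ (\bigcap_K \bigcup_n sparse X mu E k.+1%:R (K + n)) x) ->
  cyl_ball X n0 x `&` E `<=` O ->
  fine (mu (cyl_ball X n x `&` O)) / fine (mu (cyl_ball X n x))
    @[n --> \oo] --> (1 : R).
Proof.
move=> mE mO Ex Xx mu0 nsp BO; apply/cvgrPdist_le => e e0.
have [k ke] : exists k : nat, k.+1%:R^-1 <= e.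
  exists (Num.bound e^-1); rewrite invf_ple ?posrE ?ltr0n//.
  apply: (@le_trans _ _ (Num.bound e^-1)%:R); last by rewrite ler_nat.
  by apply/ltW/archi_boundP; rewrite invr_ge0 ltW.
have [K Ksp] : exists K, forall n, (K <= n)%N -> ~ sparse X mu E k.+1%:R n x.
  apply: contrapT => nK; apply: (nsp k) => K _; apply: contrapT => nU.
  apply: nK; exists K => n Kn sx; apply: nU; exists (n - K)%N => //.
  by rewrite subnKC.
exists (maxn K n0) => // n /=; rewrite geq_max => /andP[Kn n0n].
set B := cyl_ball X n x.
have mB : measurable (B : set (borel_config A)).
  exact: measurable_local (cyl_ball_local X n x).
have mBO : measurable (B `&` O : set (borel_config A)) by exact: measurableI.
have mBE : measurable (B `\` E : set (borel_config A)) by exact: measurableD.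
have fB : mu B \is a fin_num by exact: fin_num_measure.
have fBO : mu (B `&` O) \is a fin_num by exact: fin_num_measure.
have fBE : mu (B `\` E) \is a fin_num by exact: fin_num_measure.
(* [x] lies in [E], hence in [neighborhood n], so it can fail to be sparse only through the measure
   inequality. *)
have lt_dB : k.+1%:R * fine (mu (B `\` E)) < fine (mu B).
  rewrite -lte_fin EFinM !fineK// ltNge; apply/negP => sB.
  apply: (Ksp n Kn); split=> //; split=> //; exists x => //.
have le_OB : fine (mu (B `&` O)) <= fine (mu B).
  by rewrite fine_le//; apply: measureIl.
have le_B : fine (mu B) <= fine (mu (B `&` O)) + fine (mu (B `\` E)).
  rewrite -lee_fin EFinD !fineK// (measureDI mu mB mE) addeC.
  apply: leeD => //; apply: le_measure.
  - by apply/mem_set; exact: measurableI.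
  - exact/mem_set.
  - move=> y [[Xy yx] Ey]; split=> //; apply: BO; split=> //; split=> //.
    exact: window_le yx.
have B0 : 0 < fine (mu B) by rewrite -lte_fin fineK//; exact: mu0.
have -> : 1 - fine (mu (B `&` O)) / fine (mu B) =
    (fine (mu B) - fine (mu (B `&` O))) / fine (mu B).
  by rewrite mulrBl divff// gt_eqF.
rewrite ger0_norm; last by rewrite divr_ge0 ?subr_ge0 ?(ltW B0).
apply: le_trans ke; rewrite ler_pdivrMr// ler_pdivlMl; last by rewrite ltr0n.
apply: le_trans (ltW lt_dB); rewrite ler_pM2l ?ltr0n//; lra.
Qed.

End DensityPoint.

(** * Columns, and equicontinuity from local eventual periodicity *)

Section Columns.
Context {A : pointedType} (X : set (config A)) (phi : config A -> config A).
Hypotheses (CA : cellular_automaton X phi) (r : nat).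
Hypothesis phi_local : forall x y, X x -> X y ->
  window r x = window r y -> phi x 0%R = phi y 0%R.

Let clX : closed X. Proof. by case: CA => -[]. Qed.

(** The bound [a + b] serves both times at once, so one initial window determines both entries of
    the column. *)
Lemma local_columns m a b
    (Q : {ffun 'I_(m.*2.+1) -> A} -> {ffun 'I_(m.*2.+1) -> A} -> Prop) :
  local_set X (m + (a + b) * r)
    [set x | X x /\ Q (window m (iter a phi x)) (window m (iter b phi x))].
Proof.
split=> [x []//|x y [Xx Qx] Xy xy]; split=> //.
have colE i : (i <= a + b)%N ->
    window m (iter i phi x) = window m (iter i phi y).
  move=> iab; apply: (window_iter CA phi_local) => //; apply: window_le xy.
  by rewrite leq_add2l leq_mul2r iab orbT.
by rewrite -!colE// ?leq_addl ?leq_addr.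
Qed.

Lemma bigcap_local_measurable (Q : nat -> set (config A)) (f : nat -> nat) :
  (forall i, local_set X (f i) (Q i)) ->
  measurable (\bigcap_i Q i : set (borel_config A)).
Proof.
by move=> Qf; apply: bigcapT_measurable => i; exact: measurable_local (Qf i).
Qed.

(** Gives the closedness needed for density: each [Q i] is decided by a finite window, so
    approximation at every radius forces membership. *)
Lemma bigcap_local_closed (Q : nat -> set (config A)) (f : nat -> nat) :
  (forall i, local_set X (f i) (Q i)) ->
  \bigcap_n neighborhood X (\bigcap_i Q i) n `<=` \bigcap_i Q i.
Proof.
move=> Qf x xQ i _; have [Xx [y Qy xy]] := xQ (f i) I.
by have [_ +] := Qf i; apply; [exact: Qy | |].
Qed.

(** The sets E_{m,p,i0} of the overview. Keeping [i0 <= i] inside makes this an intersection of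
    local sets over all [i]. *)
Definition periodic_from m p i0 : set (config A) :=
  \bigcap_i [set x | X x /\ ((i0 <= i)%N ->
    window m (iter (i + p) phi x) = window m (iter i phi x))].

Lemma local_periodic_from m p i0 i : local_set X (m + (i + p + i) * r)
  [set x | X x /\ ((i0 <= i)%N ->
    window m (iter (i + p) phi x) = window m (iter i phi x))].
Proof. exact: local_columns (fun v w => (i0 <= i)%N -> v = w). Qed.

Lemma LEP_periodic_from :
  LEP X phi = \bigcap_m \bigcup_p \bigcup_i0 periodic_from m p.+1 i0.
Proof.
apply/seteqP; split=> [x [Xx xP] m _|x xP].
  have [p [i0 [p0 xp]]] := xP m; exists p.-1 => //; exists i0 => // i _.
  by split=> // /xp; rewrite prednK.
split=> [|m]; first by have [p _ [i0 _ /(_ 0%N I)[]]] := xP 0%N I.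
have [p _ [i0 _ pP]] := xP m I.
by exists p.+1, i0; split=> // i ii0; apply: (pP i I).2.
Qed.

Lemma measurable_LEP : measurable (LEP X phi : set (borel_config A)).
Proof.
rewrite LEP_periodic_from; apply: bigcapT_measurable => m.
apply: bigcupT_measurable => p; apply: bigcupT_measurable => i0.
exact: bigcap_local_measurable (local_periodic_from m p.+1 i0).
Qed.

Lemma measurable_orbit_ball m x :
  measurable (orbit_ball X phi m x : set (borel_config A)).
Proof.
have -> : orbit_ball X phi m x = \bigcap_i [set y | X y /\
    window m (iter i phi y) = window m (iter i phi x)].
  apply/seteqP; split=> [y [Xy yx] i _//|y yP]; split=> [|i].
    by have [] := yP 0%N I.
  by have [] := yP i I.
apply: (@bigcap_local_measurable _ (fun i => m + (i + i) * r)%N) => i.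
exact: local_columns (fun v _ => v = _).
Qed.

(** The initial window fixes the column up to time [i0 + p]; every later entry repeats, in both
    orbits, the one [p] steps earlier. *)
Lemma periodic_from_orbit_ball m p i0 x : (0 < p)%N -> periodic_from m p i0 x ->
  cyl_ball X (m + (i0 + p) * r) x `&` periodic_from m p i0
    `<=` orbit_ball X phi m x.
Proof.
move=> p0 xP y [[Xy yx] yP]; split=> // i.
have Xx : X x by have [] := xP 0%N I.
elim/ltn_ind: i => i IH; have [ip|pi] := leqP i (i0 + p).
  apply: (window_iter CA phi_local) => //; apply: window_le yx.
  by rewrite leq_add2l leq_mul2r ip orbT.
have [_ yE] := yP (i - p)%N I; have [_ xE] := xP (i - p)%N I.
have ip : (i - p + p = i)%N by lia.
rewrite -ip yE ?xE; [|lia|lia].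
by apply: IH; lia.
Qed.

Context {R : realType} (mu : probability (borel_config A) R).
Hypothesis finA : finite_set [set: A].

Lemma LEP_mu_equicontinuous : mu X = 1%E -> mu_LEP X phi mu ->
  mu_equicontinuous X phi mu.
Proof.
move=> muX muLEP.
pose null := \bigcup_n [set x | X x /\ mu (cyl_ball X n x) = 0%E].
(* Points in sparse balls of infinitely many radii for some E_{m,p,i0} and some constant [k.+1]: a
   countable union of null sets. *)
pose bad := \bigcup_m \bigcup_p \bigcup_i0 \bigcup_k
  \bigcap_K \bigcup_n sparse X mu (periodic_from m p i0) k.+1%:R (K + n).
have nulln : mu.-negligible null.
  by apply: negligible_bigcup => n; exact: null_balls_negligible.
have badn : mu.-negligible bad.
  do 4 (apply: negligible_bigcup => ?).
  apply: sparse_limsup_negligible => //.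
  - exact: bigcap_local_measurable (local_periodic_from _ _ _).
  - exact: bigcap_local_closed (local_periodic_from _ _ _).
have LEPn : mu.-negligible (~` LEP X phi).
  apply/negligibleP; first by apply: measurableC; exact: measurable_LEP.
  have := probability_setC mu measurable_LEP.
  by rewrite (muLEP : mu (LEP X phi) = 1%E) subee.
apply: negligibleS (negligibleU (negligibleU nulln badn) LEPn) => x /= nx.
apply: contrapT => nN; apply: nx => Xx m.
have mu0 n : (0 < mu (cyl_ball X n x))%E.
  rewrite lt0e measure_ge0 andbT; apply/eqP => x0; apply: nN; left; left.
  by exists n.
split=> //.
have : LEP X phi x by apply: contrapT => nL; apply: nN; right.
rewrite LEP_periodic_from => /(_ m I)[p _ [i0 _ xP]].
apply: (density_point clX _ (measurable_orbit_ball m x) xP Xx mu0).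
- exact: bigcap_local_measurable (local_periodic_from _ _ _).
- move=> k xk; apply: nN; left; right.
  by exists m => //; exists p.+1 => //; exists i0 => //; exists k.
- exact: periodic_from_orbit_ball.
Qed.

End Columns.

(** * Factors of eventually periodic sequences, and the shift as a measurable map *)

Lemma eventually_periodic_comp (T U : Type) (u : nat -> T) (v : nat -> U) :
  (forall i j, u i = u j -> v i = v j) ->
  eventually_periodic u -> eventually_periodic v.
Proof.
move=> uv [p [i0 [p0 up]]]; exists p, i0; split=> // i /up; exact: uv.
Qed.

Lemma iter_shift (A : pointedType) n (x : config A) :
  iter n shift x = translate n%:Z x.
Proof.
elim: n => [|n IH].
  by apply/funext => k; rewrite /translate addr0.
by rewrite iterS IH; apply/funext => k; rewrite /translate /shift; congr x; lia.
Qed.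

Lemma measurable_shift (A : pointedType) :
  measurable_fun setT (shift : borel_config A -> borel_config A).
Proof.
apply: (@measurability _ _ (borel_config A) (borel_config A) setT shift
  (@open (config A))) => // _ [U oU <-].
rewrite setTI; apply: sub_sigma_algebra; rewrite openE => x Ux.
have [n nU] : exists n, [set y | window n y = window n (shift x)] `<=` U.
  by apply: nbhs_configP; exact: open_nbhs_nbhs.
apply: filterS (nbhs_cylinder n.+1 x) => y /windowP yx; apply: nU.
by apply/windowP => k kn; rewrite /shift yx//; lia.
Qed.

(** * Local eventual periodicity from equicontinuity *)

Section Equicontinuous.
Context {A : pointedType} (X : set (config A)) (phi : config A -> config A).
Context {R : realType} (mu : probability (borel_config A) R).
Hypothesis finA : finite_set [set: A].
Hypotheses (sftX : sft X) (CA : cellular_automaton X phi).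
Hypothesis mu_shift : shift_invariant mu.

(** Were the orbit ball null, all ratios would be 0 and could not tend to 1. *)
Lemma equicontinuity_orbit_ball_gt0 x m :
  mu_equicontinuity_point X phi mu x -> (0 < mu (orbit_ball X phi m x))%E.
Proof.
move=> xP; have [r phi_local] := local_rule CA finA.
have mO := measurable_orbit_ball CA phi_local m x.
rewrite lt0e measure_ge0 andbT; apply/eqP => O0.
have [_] := xP m.
have -> : (fun n => fine (mu (cyl_ball X n x `&` orbit_ball X phi m x)) /
    fine (mu (cyl_ball X n x)))%R = fun=> 0%R.
  apply/funext => n.
  have clX : closed X by case: CA => -[].
  have mB : measurable (cyl_ball X n x : set (borel_config A)).
    exact: measurable_local (cyl_ball_local X n x).
  rewrite (@subset_measure0 _ _ _ mu _ (orbit_ball X phi m x)) ?mul0r//.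
  exact: measurableI.
move=> /cvg_lim; rewrite lim_cst// => /(_ (@Rhausdorff R))/eqP.
by rewrite eq_sym oner_eq0.
Qed.

Lemma equicontinuity_point_LEP x : X x ->
  mu_equicontinuity_point X phi mu x -> LEP X phi x.
Proof.
move=> Xx xP; split=> // m; have [r phi_local] := local_rule CA finA.
have [_ [F XE]] := sftX.
(* [M] dominates the requested radius, the radius of the local rule and the lengths of all forbidden
   words, as periodization requires. *)
pose M := maxn m (maxn r (\max_(w <- F) size w)).
have mM : (m <= M)%N by rewrite leq_maxl.
have rM : (r <= M)%N by rewrite /M; lia.
have FM w : w \in F -> (size w <= M)%N.
  move=> wF; rewrite /M !leq_max; apply/orP; right; apply/orP; right.
  exact: leq_bigmax_seq wF isT.
suff colP : eventually_periodic (fun i => window M (iter i phi x)).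
  by apply: eventually_periodic_comp colP => i j; exact: window_le.
have O0 := equicontinuity_orbit_ball_gt0 M xP.
have mO := measurable_orbit_ball CA phi_local M x.
(* [J := M.+1] forces the return time [n], which becomes the period, to exceed [M]. *)
have [//|n [y [Mn [Xy yx] []]]] :=
  poincare_recurrence (@measurable_shift A) mO mu_shift (J := M.+1) O0.
rewrite iter_shift => _ nyx.
(* [y] and its translate by [n] both lie in the orbit ball of [x], and [phi] commutes with
   translation. *)
have yy i : window M (iter i phi y) = window M (translate n%:Z (iter i phi y)).
  rewrite yx -nyx; congr window.
  elim: i => //= i ->; apply: (phi_translate CA).
  exact: (iter_mem CA).
have Xp : X (periodize n y) by exact: periodize_sft Mn XE FM (yy 0%N) Xy.
have := recurrent_column_periodic CA phi_local finA Mn rM Xy Xp yy.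
by apply: eventually_periodic_comp => i j; rewrite !yx.
Qed.

Lemma mu_equicontinuous_LEP : mu X = 1%E ->
  mu_equicontinuous X phi mu -> mu_LEP X phi mu.
Proof.
move=> muX [N [mN N0 eqN]]; have [r phi_local] := local_rule CA finA.
have mL := measurable_LEP CA phi_local.
have mX : measurable (X : set (borel_config A)).
  by apply: measurable_closed_config; case: CA => -[].
have mXN : measurable (X `\` N : set (borel_config A)) by exact: measurableD.
apply/eqP; rewrite eq_le probability_le1//= -muX (measureDI mu mX mN).
rewrite (@subset_measure0 _ _ _ mu (X `&` N) N) ?adde0//; last first.
  exact: measurableI.
apply: le_measure; [exact/mem_set|exact/mem_set|].
move=> x [Xx nNx]; apply: equicontinuity_point_LEP => //.
by apply: contrapT => nx; apply: nNx; apply: eqN => /= /(_ Xx).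
Qed.

End Equicontinuous.

Theorem proposition2p20 (R : realType) (A : pointedType)
    (finA : finite_set [set: A])
    (X : set (config A)) (phi : config A -> config A)
    (mu : probability (borel_config A) R) :
  sft X -> cellular_automaton X phi ->
  mu X = 1%E -> shift_invariant mu ->
  mu_equicontinuous X phi mu <-> mu_LEP X phi mu.
Proof.
move=> sftX CA muX mu_shift; have [r phi_local] := local_rule CA finA.
split; first exact: mu_equicontinuous_LEP.
exact: (LEP_mu_equicontinuous CA phi_local).
Qed.
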